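(* Let Problem (P), the tolerance $\varepsilon>0$, the parameter $\lambda\in(0,1/2]$, and the iterative method (the ''Algorithm'') be as described in the context. Then there exists a constant $K<\infty$ such that the Algorithm either terminates with an approximate global optimal solution $x^{k^*}$ of Problem (P) or with the indication of infeasibility of Problem (P), in an iteration $k^*\le K$.
   Context: **Problem (P).** $\min_x c^\top x$ subject to $Ax\ge b$, $\underline{x}\le x\le \bar{x}$, $x\in\mathbb{R}^n\times\mathbb{Z}^m$, and $f_i(x_{I_i})=x_{r_i}$ for $i\in[p]:=\{1,\dots,p\}$. Here $c\in\mathbb{R}^{n+m}$, $A\in\mathbb{R}^{q\times(n+m)}$, $b\in\mathbb{R}^q$, and $\underline{x},\bar{x}\in\mathbb{R}^n\times\mathbb{Z}^m$ are finite bounds. For each $i$: $I_i\subset[n]:=\{1,\dots,n\}$, $l_i=|I_i|$, $r_i\in[n]\setminus I_i$, and $f_i:\mathbb{R}^{l_i}\to\mathbb{R}$ is Lipschitz continuous. Write $x_{\mathcal{I}_i}=(x_{I_i},x_{r_i})\in\mathbb{R}^{l_i+1}$. **$\varepsilon$-relaxed problem.** Problem (P) with $f_i(x_{I_i})=x_{r_i}$ replaced by $|f_i(x_{I_i})-x_{r_i}|\le\varepsilon$ for all $i\in[p]$. A global solution of the $\varepsilon$-relaxed problem is called an *approximate global optimal solution* of (P). **Boxes.** For $\underline{v}\le\bar{v}$ in $\mathbb{R}^d$, $B(\underline{v},\bar{v})=\{x\in\mathbb{R}^d:\underline{v}\le x\le\bar{v}\}$ (componentwise). For a point $x$ with $\underline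 v<x<\bar v$ the split of the box is $S(\underline{v},\bar{v},x)=\{B(\underline{w},\bar{w}) : (\underline{w}_\ell=\underline{v}_\ell\wedge\bar{w}_\ell=x_\ell)\vee(\underline{w}_\ell=x_\ell\wedge\bar{w}_\ell=\bar{v}_\ell)\ \text{for all } \ell\in\{1,\dots,d\}\}$. **Relaxation.** $L_i$ is the Lipschitz constant of $f_i$ on $B(\underline{x}_{I_i},\bar{x}_{I_i})$ with respect to a given norm $\|\cdot\|$ on $\mathbb{R}^{l_i}$, where any (weighted) norm can be used. In iteration $k$, for each $i$ there is a finite set of boxes $\mathcal{X}_i^k=\{B(\underline{v}_i^k(j),\bar{v}_i^k(j)) : j\in J_i^k\}$ in $\mathbb{R}^{l_i}$. With $m_i^k(j)=\frac12(\underline{v}_i^k(j)+\bar{v}_i^k(j))$ let $\Omega_i^k(j)=\{(x_{I_i},x_{r_i})\in\mathbb{R}^{l_i+1}: \underline{v}_i^k(j)\le x_{I_i}\le\bar{v}_i^k(j),\ |x_{r_i}-f_i(m_i^k(j))|\le\frac12L_i\|\bar{v}_i^k(j)-\underline{v}_i^k(j)\|\}$ and $\Omega_i^k=\bigcup_{j\in J_i^k}\Omega_i^k(j)$. For fixed $\lambda\in(0,1/2]$ let $\tilde\Omega_i^k(j)=\Omega_i^k(j)\cap\{(x_{I_i},x_{r_i})\in\mathbb{R}^{l_i+1} : (1-\lambda)\underline{v}_i^k(j)+\lambda\bar{v}_i^k(j)\le x_{I_i}\le\lambda\underline{v}_i^k(j)+(1-\lambda)\bar{v}_i^k(j)\}$.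 **Master problem M($k$).** $\min_x c^\top x$ s.t. $Ax\ge b$, $\underline{x}\le x\le\bar{x}$, $x\in\mathbb{R}^n\times\mathbb{Z}^m$, $x_{\mathcal{I}_i}\in\Omega_i^k$ for $i\in[p]$. **Subproblem S($k$).** $\min_{\tilde{x}}\|\tilde{x}-x^k\|_2^2$ s.t. $f_i(\tilde{x}_{I_i})=\tilde{x}_{r_i}$, $\tilde{x}_{\mathcal{I}_i}\in\tilde\Omega_i^k(j_i^k)$ for $i\in[p]$. **Algorithm.** Initialize $\mathcal{X}_i^0=\{B(\underline{x}_{I_i},\bar{x}_{I_i})\}$ for all $i\in[p]$. For $k=0,1,2,\dots$: 1. Solve M($k$) to global optimality. If it is infeasible, stop and report that (P) is infeasible. Otherwise let $x^k$ denote the optimal solution of M($k$). 2. If $|f_i(x^k_{I_i})-x^k_{r_i}|\le\varepsilon$ for all $i\in[p]$, stop and return $x^k$. 3. For each $i\in[p]$ determine $j_i^k\in J_i^k$ with $x^k_{\mathcal{I}_i}\in\Omega_i^k(j_i^k)$. 4. Solve S($k$) and let $\tilde{x}^k$ denote the optimal solution. 5. For each $i\in[p]$: if $|f_i(x^k_{I_i})-x^k_{r_i}|>\varepsilon$, set $\mathcal{X}_i^{k+1}=(\mathcal{X}_i^k\setminus\{B(\underline{v}_i^k(j_i^k),\bar{v}_i^k(j_i^k))\})\cup S(\underline{v}_i^k(j_i^k),\bar{v}_i^k(j_i^k),\tilde{x}^k_{I_i})$; otherwise $\mathcal{X}_i^{k+1}=\mathcal{X}_i^k$.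
   Formalization: The returned point is ε-feasible with objective at most that of every feasible point of (P), not shown optimal for the ε-relaxed problem (false: min x_2, f=0), and the norms must be monotone in absolute values of entries, e.g. weighted l^p (for general norms M(k) may fail to relax (P)). *)

(* Defs.v *)
From HB Require Import structures.
From mathcomp Require Import all_boot all_order all_algebra.
From mathcomp Require Import boolp classical_sets reals topology normedtype.

Set Implicit Arguments.
Unset Strict Implicit.
Unset Printing Implicit Defensive.

Import Order.TTheory GRing.Theory Num.Theory.
Import numFieldNormedType.Exports.

Local Open Scope classical_set_scope.
Local Open Scope ring_scope.

Definition cvle (R : realType) (d : nat) (u v : 'cV[R]_d) : Prop :=
  forall l : 'I_d, u l 0 <= v l 0.

(* Data of Problem (P): the first n variables are continuous, the last m are
   integer. *)
Record problem (R : realType) (n m p q : nat) := Problem {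
  cost : 'cV[R]_(n + m);
  lhs : 'M[R]_(q, n + m);
  rhs : 'cV[R]_q;
  lbound : 'cV[R]_(n + m);
  ubound : 'cV[R]_(n + m);
  args : 'I_p -> {set 'I_n};
  res : 'I_p -> 'I_n;
  fct : forall i : 'I_p, 'cV[R]_(#|args i|) -> R }.

Section Problem.
Context {R : realType} {n m p q : nat} (P : problem R n m p q).
Implicit Types (x y : 'cV[R]_(n + m)) (i : 'I_p) (eps : R).

Definition mixed_integer x : Prop :=
  forall j : 'I_m, x (rshift n j) 0 \is a Num.int.

(* x_{I_i}, listed in increasing order of the indices in I_i *)
Definition xargs i x : 'cV[R]_(#|args P i|) :=
  \col_k x (lshift m (enum_val k)) 0.

Definition xres i x : R := x (lshift m (res P i)) 0.

Definition residual i x : R := `|fct (xargs i x) - xres i x|.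

Definition objective x : R := ((cost P)^T *m x) 0 0.

Definition linear_feasible x : Prop :=
  [/\ cvle (rhs P) (lhs P *m x), cvle (lbound P) x, cvle x (ubound P)
    & mixed_integer x].

Definition feasible x : Prop :=
  linear_feasible x /\ forall i, fct (xargs i x) = xres i x.

Definition eps_feasible eps x : Prop :=
  linear_feasible x /\ forall i, residual i x <= eps.

(* Optimality is measured against the feasible points of (P).  It cannot be
   measured against all eps-feasible points: the master problem relaxes (P) but
   not the eps-relaxed problem, so a point returned by the algorithm need not
   minimise the objective over the latter.  With f = 0 and objective x_2 on
   [-1, 1]^2, where x_2 = f(x_1), the algorithm returns x_2 = 0 at once, whereas
   the eps-relaxed problem has optimal value - eps for eps <= 1. *)
Definition approx_global_optimal eps x : Prop :=
  eps_feasible eps x /\ forall y, feasible y -> objective x <= objective y.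

Definition infeasible : Prop := ~ exists x, feasible x.

Definition wf_problem : Prop :=
  [/\ mixed_integer (lbound P), mixed_integer (ubound P),
      forall i, res P i \notin args P i
    & forall i, [lipschitz fct u | u in [set: 'cV[R]_(#|args P i|)]]].

End Problem.

(* Norms on R^d that are monotone in the absolute values of the entries, such as
   all weighted l^p norms.  Without monotonicity the half-diameter bound
   N (u - midpoint) <= N (vbar - v) / 2 on a box fails, and then the master
   problem need not be a relaxation of (P). *)
Definition monotone_norm (R : realType) (d : nat) (N : 'cV[R]_d -> R) : Prop :=
  [/\ forall u v : 'cV[R]_d, N (u + v) <= N u + N v,
      forall (a : R) (u : 'cV[R]_d), N (a *: u) = `|a| * N u,
      forall u : 'cV[R]_d, N u = 0 -> u = 0
    & forall u v : 'cV[R]_d, (forall l, `|u l 0| <= `|v l 0|) -> N u <= N v].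

(* The pair (v, vbar) stands for the box B(v, vbar). *)
Definition box (R : realType) (d : nat) : Type := ('cV[R]_d * 'cV[R]_d)%type.

Definition in_box (R : realType) (d : nat) (B : box R d) (u : 'cV[R]_d) : Prop :=
  cvle B.1 u /\ cvle u B.2.

Definition midpoint (R : realType) (d : nat) (B : box R d) : 'cV[R]_d :=
  2^-1 *: (B.1 + B.2).

Definition split_box (R : realType) (d : nat) (B : box R d) (z : 'cV[R]_d) :
    set (box R d) :=
  [set W : box R d | forall l, (W.1 l 0 = B.1 l 0 /\ W.2 l 0 = z l 0) \/
                             (W.1 l 0 = z l 0 /\ W.2 l 0 = B.2 l 0)].

Definition shrink_box (R : realType) (d : nat) (lambda : R) (B : box R d) :
    box R d :=
  ((1 - lambda) *: B.1 + lambda *: B.2, lambda *: B.1 + (1 - lambda) *: B.2).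

Section Algorithm.
Context {R : realType} {n m p q : nat} (P : problem R n m p q).
Variables (N : forall i : 'I_p, 'cV[R]_(#|args P i|) -> R) (L : 'I_p -> R).
Implicit Types (x y : 'cV[R]_(n + m)) (i : 'I_p) (eps lambda : R).

Definition initial_box i : box R #|args P i| :=
  (xargs P i (lbound P), xargs P i (ubound P)).

Definition lipschitz_constant i : Prop :=
  0 <= L i /\
  forall u v, in_box (initial_box i) u -> in_box (initial_box i) v ->
    `|fct u - fct v| <= L i * N (u - v).

(* Omega B x says that (x_{I_i}, x_{r_i}) lies in the set Omega_i of box B. *)
Definition Omega i (B : box R #|args P i|) x : Prop :=
  in_box B (xargs P i x) /\
  `|xres P i x - fct (midpoint B)| <= 2^-1 * L i * N (B.2 - B.1).

Definition Omega_inner lambda i (B : box R #|args P i|) x : Prop :=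
  Omega B x /\ in_box (shrink_box lambda B) (xargs P i x).

(* A box collection is a set of boxes, so the boxes are their own indices. *)
Definition collection : Type := forall i : 'I_p, set (box R #|args P i|).

Definition master_feasible (X : collection) x : Prop :=
  linear_feasible P x /\ forall i, exists2 B, X i B & Omega B x.

Definition master_optimal (X : collection) x : Prop :=
  master_feasible X x /\
  forall y, master_feasible X y -> objective P x <= objective P y.

Definition master_infeasible (X : collection) : Prop :=
  ~ exists x, master_feasible X x.

Definition sub_feasible lambda (J : forall i, box R #|args P i|) z : Prop :=
  forall i, fct (xargs P i z) = xres P i z /\ Omega_inner lambda (J i) z.

Definition sqdist x y : R := \sum_k (x k 0 - y k 0) ^+ 2.

Definition sub_optimal lambda (J : forall i, box R #|args P i|) x z : Prop :=
  sub_feasible lambda J z /\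
  forall y, sub_feasible lambda J y -> sqdist z x <= sqdist y x.

(* X^k, x^k, the boxes selected by the indices j_i^k, and the solution of S(k);
   entries past the stopping iteration are meaningless. *)
Record trace := Trace {
  boxes : nat -> collection;
  master_sol : nat -> 'cV[R]_(n + m);
  selected : nat -> forall i, box R #|args P i|;
  sub_sol : nat -> 'cV[R]_(n + m) }.

Arguments boxes : clear implicits.
Arguments selected : clear implicits.

Definition stops_infeasible (T : trace) (k : nat) : Prop :=
  master_infeasible (boxes T k).

Definition returns eps (T : trace) (k : nat) : Prop :=
  ~ stops_infeasible T k /\ forall i, residual P i (master_sol T k) <= eps.

Definition stops eps (T : trace) (k : nat) : Prop :=
  stops_infeasible T k \/ returns eps T k.

Definition refine eps (T : trace) (k : nat) i : set (box R #|args P i|) :=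
  if eps < residual P i (master_sol T k) then
    (boxes T k i `\ selected T k i) `|`
    split_box (selected T k i) (xargs P i (sub_sol T k))
  else boxes T k i.

Arguments refine : clear implicits.

Definition iteration eps lambda (T : trace) (k : nat) : Prop :=
  (~ stops_infeasible T k -> master_optimal (boxes T k) (master_sol T k)) /\
  (~ stops eps T k ->
   [/\ forall i, boxes T k i (selected T k i) /\
                 Omega (selected T k i) (master_sol T k),
       sub_optimal lambda (selected T k) (master_sol T k) (sub_sol T k)
     & forall i, boxes T k.+1 i = refine eps T k i]).

Definition run eps lambda (T : trace) : Prop :=
  (forall i, boxes T 0 i = [set initial_box i]) /\
  forall k, (forall k', (k' < k)%N -> ~ stops eps T k') ->
    iteration eps lambda T k.

End Algorithm.

(* Main.v *)
Require Import Defs.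
From HB Require Import structures.
From mathcomp Require Import all_boot all_order all_algebra.
From mathcomp Require Import boolp classical_sets reals topology normedtype.
From mathcomp Require Import sequences lra.

Set Implicit Arguments.
Unset Strict Implicit.
Unset Printing Implicit Defensive.

Import Order.TTheory GRing.Theory Num.Theory.
Import numFieldNormedType.Exports.
Local Open Scope ring_scope.

(** The boxes of each collection always cover the initial box, and on each of
    them the Lipschitz bound together with the half-diameter estimate
    [monotone_norm_halfdiam] puts the graph of the function inside Omega
    ([Omega_graph]).  The master problem is therefore a relaxation of (P) in
    every iteration, so that whatever the algorithm reports when it first stops
    is correct ([first_stop_correct]).

    It remains to bound the number of iterations.  A point of Omega over a box
    of diameter D has residual at most L * D ([Omega_residual]), so only boxes
    with L * D > eps are ever split.  The split point keeps a relative distance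
    lambda from the sides of the box, so every side, and hence D by monotonicity
    of the norm, shrinks at least by the factor 1 - lambda.  Along any chain of
    nested splits this can happen only boundedly often before L * D <= eps.

    To turn this into a bound on the run, give each box a weight that is
    exponential in the number of splits still possible below it.  With a base
    exceeding the number of children of a split, a box outweighs all its
    children together ([box_weight]), so that the total weight of the
    collections drops by at least one in each iteration that does not stop
    ([iteration_weight]).  The weights depend only on the problem data, and the
    total weight of the initial boxes is the constant K. *)

(** * Boxes and their splits *)

Definition subbox (R : realType) (d : nat) (A B : box R d) : Prop :=
  cvle B.1 A.1 /\ cvle A.2 B.2.

Lemma in_subbox (R : realType) (d : nat) (A B : box R d) (u : 'cV[R]_d) :
  subbox A B -> in_box A u -> in_box B u.
Proof.
move=> [AB1 AB2] [u1 u2]; split=> l; first exact: le_trans (AB1 l) (u1 l).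
exact: le_trans (u2 l) (AB2 l).
Qed.

Lemma in_box_le (R : realType) (d : nat) (B : box R d) (u : 'cV[R]_d) :
  in_box B u -> cvle B.1 B.2.
Proof. by move=> [u1 u2] l; apply: le_trans (u1 l) (u2 l). Qed.

Lemma in_box_midpoint (R : realType) (d : nat) (B : box R d) :
  cvle B.1 B.2 -> in_box B (midpoint B).
Proof. by move=> B12; split=> l; have := B12 l; rewrite !mxE; lra. Qed.

Lemma in_shrink_box (R : realType) (d : nat) (lambda : R) (B : box R d)
    (z : 'cV[R]_d) :
  0 < lambda <= 2^-1 -> cvle B.1 B.2 -> in_box (shrink_box lambda B) z ->
  in_box B z.
Proof.
move=> /andP[l0 l1] B12 [z1 z2]; split=> l;
  have := B12 l; have := z1 l; have := z2 l; rewrite !mxE; nra.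
Qed.

(** The set [e] records the coordinates in which the upper part is taken.  On a
    degenerate box several [e] give the same child, so the list may have
    repetitions, but its length is the same for all boxes. *)
Definition split_boxes (R : realType) (d : nat) (B : box R d) (z : 'cV[R]_d) :
    seq (box R d) :=
  [seq (\col_l (if l \in e then z l 0 else B.1 l 0),
        \col_l (if l \in e then B.2 l 0 else z l 0)) | e : {set 'I_d}].

Lemma split_boxesP (R : realType) (d : nat) (B : box R d) (z : 'cV[R]_d)
    (W : box R d) :
  reflect (split_box B z W) (W \in split_boxes B z).
Proof.
apply: (iffP mapP) => [[e _ ->] l /=|spl].
  by rewrite !mxE; case: (l \in e); [right|left].
exists [set l | (W.1 l 0 == z l 0) && (W.2 l 0 == B.2 l 0)].
  by rewrite mem_enum.
rewrite [LHS]surjective_pairing; congr pair; apply/colP => l; rewrite !mxE inE;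
  by case: (spl l) => -[-> ->]; rewrite ?eqxx //;
    case: andP => // -[/eqP ? /eqP].
Qed.

Lemma split_box_cover (R : realType) (d : nat) (B : box R d) (z u : 'cV[R]_d) :
  in_box B u -> exists2 W, split_box B z W & in_box W u.
Proof.
move=> [u1 u2].
exists (\col_l (if z l 0 <= u l 0 then z l 0 else B.1 l 0),
        \col_l (if z l 0 <= u l 0 then B.2 l 0 else z l 0)).
  by move=> l /=; rewrite !mxE; case: ifP => _; [right|left].
by split=> l /=; rewrite !mxE; case: (leP (z l 0)) => // /ltW.
Qed.

Lemma split_box_subbox (R : realType) (d : nat) (B W : box R d) (z : 'cV[R]_d) :
  in_box B z -> split_box B z W -> subbox W B.
Proof.
by move=> [z1 z2] spl; split=> l; case: (spl l) => -[W1 W2]; rewrite ?W1 ?W2.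
Qed.

(** In each coordinate the two parts end at z, which lies at least lambda times
    the side length away from both ends.  The bound is stated entrywise with
    absolute values so that a monotone norm applies to it. *)
Lemma split_box_side (R : realType) (d : nat) (lambda : R) (B W : box R d)
    (z : 'cV[R]_d) (l : 'I_d) :
  0 < lambda <= 2^-1 -> cvle B.1 B.2 -> in_box (shrink_box lambda B) z ->
  split_box B z W ->
  `|(W.2 - W.1) l 0| <= `|((1 - lambda) *: (B.2 - B.1)) l 0|.
Proof.
move=> hl B12 zB spl.
have [B1z zB2] := in_shrink_box hl B12 zB.
have := B12 l; have := B1z l; have := zB2 l.
case: zB => /(_ l) z1 /(_ l) z2; move: z1 z2; rewrite !mxE.
case/andP: hl => l0 l1 z1 z2 zB2l B1zl B12l.
rewrite [leRHS]ger0_norm; last by apply: mulr_ge0; lra.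
by case: (spl l) => -[-> ->]; rewrite ger0_norm; nra.
Qed.

(** * The number of splits still possible below a box *)

(** Entrywise, no point of a box is further from the midpoint than half the
    side, and a monotone norm respects entrywise domination. *)
Lemma monotone_norm_halfdiam (R : realType) (d : nat) (N : 'cV[R]_d -> R)
    (B : box R d) (u : 'cV[R]_d) :
  monotone_norm N -> in_box B u ->
  N (u - midpoint B) <= 2^-1 * N (B.2 - B.1).
Proof.
move=> [_ homN _ monN] [u1 u2].
rewrite -[2^-1]ger0_norm ?invr_ge0 // -homN; apply: monN => l.
have := u1 l; have := u2 l; rewrite !mxE => u2l u1l.
by rewrite [leRHS]ger0_norm ?ler_norml; lra.
Qed.

(** The rank of x is the least k with r ^+ k * x <= eps: multiplying x by r
    saves one of these k steps, and k > 0 exactly when eps < x. *)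
Lemma geometric_rank (R : realType) (r eps : R) :
  0 <= r < 1 -> 0 < eps ->
  exists h : R -> nat,
    forall x y, eps < x -> y <= r * x -> (h y < h x)%N.
Proof.
move=> /andP[r0 r1] eps0.
have small x : exists k, r ^+ k * x <= eps.
  have : `|r| < 1 by rewrite ger0_norm.
  move=> /cvg_expr r_to0.
  (* adding 1 keeps the threshold positive and defined when x = 0 *)
  have x1 : 0 < `|x| + 1 by rewrite ltr_wpDl.
  have := cvgr0_norm_le _ r_to0 _ (divr_gt0 eps0 x1).
  move=> [k _ /(_ k (leqnn k))] /=; rewrite ler_pdivlMr // => rk.
  exists k; apply: le_trans rk; apply: le_trans (ler_norm _) _.
  by rewrite normrM ler_wpM2l // lerDl.
exists (fun x => ex_minn (small x)) => x y xeps yx.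
case: ex_minnP => a _ amin; case: ex_minnP => -[|b] bP _.
  by move: bP; rewrite expr0 mul1r leNgt xeps.
rewrite ltnS; apply: amin; apply: le_trans bP.
by rewrite exprSr -mulrA ler_wpM2l // exprn_ge0.
Qed.

(** With M the number of children and h the geometric rank of L times the
    diameter, the weight is M.+1 ^ h.  All children have rank below h, so they
    weigh at most M * M.+1 ^ h.-1 together. *)
Lemma box_weight (R : realType) (d : nat) (N : 'cV[R]_d -> R)
    (L eps lambda : R) :
  monotone_norm N -> 0 <= L -> 0 < eps -> 0 < lambda <= 2^-1 ->
  exists w : box R d -> nat, forall B z,
    cvle B.1 B.2 -> in_box (shrink_box lambda B) z ->
    eps < L * N (B.2 - B.1) ->
    (\sum_(W <- split_boxes B z) w W < w B)%N.
Proof.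
move=> [_ homN _ monN] L0 eps0 hl; have /andP[l0 l1] := hl.
have [|h hP] := @geometric_rank _ (1 - lambda) eps _ eps0; first by lra.
set M := #|{set 'I_d}|.
exists (fun B => M.+1 ^ h (L * N (B.2 - B.1))%R)%N => B z B12 zB wide.
set k := h _.
have rank W : W \in split_boxes B z -> (h (L * N (W.2 - W.1))%R < k)%N.
  move=> /split_boxesP spl; apply: hP => //.
  rewrite mulrCA ler_wpM2l // -[1 - lambda]ger0_norm; last by lra.
  by rewrite -homN; apply: monN => l; apply: split_box_side spl.
(* the rank of any child witnesses that the rank of B is positive *)
have k_gt0 : (0 < k)%N.
  have [W /split_boxesP/rank rkW _] : exists2 W, split_box B z W & in_box W z.
    by apply: split_box_cover; apply: in_shrink_box zB.
  exact: leq_ltn_trans (leq0n _) rkW.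
apply: (@leq_ltn_trans (\sum_(W <- split_boxes B z) M.+1 ^ k.-1)%N).
  rewrite !big_seq; apply: leq_sum => W /rank; rewrite -(prednK k_gt0) ltnS.
  exact: leq_pexp2l.
rewrite big_const_seq iter_addn_0 count_predT size_image -/M.
by rewrite -[in ltnRHS](prednK k_gt0) expnS mulnC ltn_pmul2r ?expn_gt0.
Qed.

(** * Total weight of a collection *)

(** The list covers X rather than enumerating it, so that replacing a box by its
    children is a filter followed by a concatenation, even when a child
    coincides with another box of X: counting it twice only raises the sum. *)
Definition weight_at_most (T : eqType) (w : T -> nat) (X : set T) (c : nat) :
    Prop :=
  exists2 s : seq T, forall B, X B -> B \in s & (\sum_(B <- s) w B <= c)%N.

Lemma weight_at_most_replace (T : eqType) (w : T -> nat) (X : set T) (c : nat)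
    (B : T) (s : seq T) (Y : set T) :
  weight_at_most w X c -> X B -> (forall W, Y W -> W \in s) ->
  (\sum_(W <- s) w W < w B)%N ->
  exists2 c', (c' < c)%N & weight_at_most w ((X `\ B) `|` Y)%classic c'.
Proof.
move=> [t Xt tc] XB Ys sB; have Bt := Xt _ XB.
exists (\sum_(W <- [seq W <- t | W != B] ++ s) w W)%N; last first.
  exists ([seq W <- t | W != B] ++ s) => // W.
  rewrite mem_cat mem_filter => -[[/Xt -> /= /eqP ->] //|/Ys ->].
  by rewrite orbT.
apply: leq_trans tc; rewrite big_cat /= [in ltnRHS](bigID (pred1 B)) /=.
rewrite big_filter addnC -addSn leq_add2r.
apply: leq_trans sB _.
by rewrite (big_rem _ Bt) /= eqxx leq_addr.
Qed.

(** * Runs of the algorithm *)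

Section Run.
Context {R : realType} {n m p q : nat} (P : problem R n m p q).
Context (N : forall i : 'I_p, 'cV[R]_(#|args P i|) -> R) (L : 'I_p -> R).
Context (eps lambda : R).
Context (hN : forall i, monotone_norm (@N i)).
Context (hL : forall i, lipschitz_constant N L i).
Context (hlambda : 0 < lambda <= 2^-1).

(** The midpoint of B is within half the diameter of any point of B, which is
    why the factor 1/2 in the definition of Omega suffices.  Lipschitz
    continuity is only available on the initial box, hence the inclusion. *)
Lemma Omega_graph (i : 'I_p) (B : box R #|args P i|) (x : 'cV[R]_(n + m)) :
  subbox B (initial_box P i) -> in_box B (xargs P i x) ->
  fct (xargs P i x) = xres P i x -> Omega N L B x.
Proof.
move=> Bi xB fx; split=> //; rewrite -fx.
have [L0 lipL] := hL i.
have B12 := in_box_le xB.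
have mB := in_box_midpoint B12.
apply: le_trans (lipL _ _ (in_subbox Bi xB) (in_subbox Bi mB)) _.
by rewrite -mulrA mulrCA ler_wpM2l ?monotone_norm_halfdiam.
Qed.

(** Going through the value at the midpoint, one half of the bound comes from
    the Lipschitz condition and the other from the definition of Omega. *)
Lemma Omega_residual (i : 'I_p) (B : box R #|args P i|) (x : 'cV[R]_(n + m)) :
  subbox B (initial_box P i) -> Omega N L B x ->
  residual P i x <= L i * N (B.2 - B.1).
Proof.
move=> Bi [xB xr]; have [L0 lipL] := hL i.
have B12 := in_box_le xB.
have lipx :=
  lipL _ _ (in_subbox Bi xB) (in_subbox Bi (in_box_midpoint B12)).
have half := ler_wpM2l L0 (monotone_norm_halfdiam (hN i) xB).
rewrite /residual; rewrite distrC in xr.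
apply: le_trans (ler_distD (fct (midpoint B)) _ _) _.
lra.
Qed.

(** The loop invariant of the algorithm. *)
Definition box_cover (i : 'I_p) (X : set (box R #|args P i|)) : Prop :=
  (forall B, X B -> subbox B (initial_box P i)) /\
  (forall u, in_box (initial_box P i) u -> exists2 B, X B & in_box B u).

Lemma box_cover_replace (i : 'I_p) (X : set (box R #|args P i|))
    (B : box R #|args P i|) (z : 'cV[R]_(#|args P i|)) :
  box_cover X -> X B -> in_box B z ->
  box_cover ((X `\ B) `|` split_box B z)%classic.
Proof.
move=> [Xsub Xcov] XB zB; split=> [W [[/Xsub //]|spl]|u /Xcov[C XC uC]].
  have [W1 W2] := split_box_subbox zB spl; have [B1 B2] := Xsub _ XB.
  by split=> l; [apply: le_trans (W1 l)|apply: le_trans (W2 l) _].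
have [CB|CB] := eqVneq C B.
  rewrite CB in uC; have [W spl uW] := split_box_cover z uC.
  by exists W => //; right.
by exists C => //; left; split=> //=; apply/eqP.
Qed.

Lemma feasible_master (X : collection P) (y : 'cV[R]_(n + m)) :
  (forall i, box_cover (X i)) -> feasible P y -> master_feasible N L X y.
Proof.
move=> Xcov [lfy fy]; split=> // i; have [Xsub Xin] := Xcov i.
have [|B XB yB] := Xin (xargs P i y); last first.
  by exists B => //; apply: Omega_graph => //; apply: Xsub.
by case: lfy => _ lb ub _; split=> l; rewrite !mxE; [apply: lb|apply: ub].
Qed.

Lemma unstopped_cover (T : trace P) (k : nat) : run N L eps lambda T ->
  (forall k', (k' < k)%N -> ~ stops N L eps T k') ->
  forall i, box_cover (boxes T k (i:=i)).
Proof.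
move=> [T0 TS]; elim: k => [|k IH] unst i.
  by rewrite T0; split=> [B /= ->|u uB]; [split=> l|exists (initial_box P i)].
have unst' k' (lt : (k' < k)%N) := unst k' (ltnW lt).
have [_ /(_ (unst k (ltnSn k)))[sel [sub _] nxt]] := TS k unst'.
rewrite nxt /refine; case: ifP => // _; last exact: IH.
have [XB [xB _]] := sel i; have [_ [_ zB]] := sub i.
apply: box_cover_replace XB _; first exact: IH.
exact: in_shrink_box hlambda (in_box_le xB) zB.
Qed.

(** The numbers c i bound the weights of the p collections.  A collection is
    refined only if its residual exceeds eps, and then the split box has
    eps < L * D by [Omega_residual], so its bound drops; an iteration that does
    not stop has at least one such residual. *)
Lemma iteration_weight (w : forall i, box R #|args P i| -> nat)
    (T : trace P) (k : nat) :
  (forall i (B : box R #|args P i|) z,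
     cvle B.1 B.2 -> in_box (shrink_box lambda B) z ->
     eps < L i * N (B.2 - B.1) ->
     (\sum_(W <- split_boxes B z) w i W < w i B)%N) ->
  run N L eps lambda T ->
  (forall k', (k' <= k)%N -> ~ stops N L eps T k') ->
  forall c : 'I_p -> nat,
  (forall i, weight_at_most (w i) (boxes T k (i:=i)) (c i)) ->
  exists2 c' : 'I_p -> nat, (\sum_i c' i < \sum_i c i)%N &
  forall i, weight_at_most (w i) (boxes T k.+1 (i:=i)) (c' i).
Proof.
move=> wP Trun unst c wc.
have unst' k' (lt : (k' < k)%N) := unst k' (ltnW lt).
have cov := unstopped_cover Trun unst'.
have nstop := unst k (leqnn k).
have [_ /(_ nstop)[sel [sub _] nxt]] := Trun.2 k unst'.
set bad := fun i => eps < residual P i (master_sol T k).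
have step i : exists c', [/\ (c' <= c i)%N, bad i -> (c' < c i)%N &
    weight_at_most (w i) (boxes T k.+1 (i:=i)) c'].
  rewrite nxt /refine -/(bad i); case: ifP => badi; last by exists (c i).
  have [XB xB] := sel i; have [_ [_ zB]] := sub i.
  have [c' lt wc'] : exists2 c', (c' < c i)%N & weight_at_most (w i)
      ((boxes T k (i:=i) `\ selected T k i) `|`
       split_box (selected T k i) (xargs P i (sub_sol T k)))%classic c'.
    apply: (weight_at_most_replace (wc i) XB).
      by move=> W /split_boxesP; apply.
    apply: wP (in_box_le xB.1) zB _.
    exact: lt_le_trans badi (Omega_residual ((cov i).1 _ XB) xB).
  by exists c'; split=> //; apply: ltnW.
have [c' c'P] := choice step; exists c'; last by move=> i; case: (c'P i).
have [i0 bad0] : exists i, bad i.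
  apply: contrapT => nbad; apply: nstop.
  have [?|ninf] := pselect (stops_infeasible N L T k); [by left|right].
  by split=> // i; rewrite leNgt; apply/negP => badi; apply: nbad; exists i.
rewrite (bigD1 i0) //= [in ltnRHS](bigD1 i0) //= -addSn.
by apply: leq_add; [case: (c'P i0) => _ /(_ bad0)
                   |apply: leq_sum => i _; case: (c'P i)].
Qed.

Lemma first_stop_correct (T : trace P) (k : nat) : run N L eps lambda T ->
  (forall k', (k' < k)%N -> ~ stops N L eps T k') -> stops N L eps T k ->
  (returns N L eps T k /\ approx_global_optimal P eps (master_sol T k)) \/
  (stops_infeasible N L T k /\ infeasible P).
Proof.
move=> Trun unst; have cov := unstopped_cover Trun unst.
case=> [inf|ret]; [right|left]; split=> //.
  by move=> [y fy]; apply: inf; exists y; apply: feasible_master.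
have [/(_ ret.1)[[lf _] opt] _] := Trun.2 k unst.
split; first by split=> // i; apply: ret.2.
by move=> y fy; apply: opt; apply: feasible_master.
Qed.

End Run.

Theorem theorem3p6 (R : realType) (n m p q : nat) (P : problem R n m p q)
    (N : forall i : 'I_p, 'cV[R]_(#|args P i|) -> R) (L : 'I_p -> R)
    (eps lambda : R)
    (hP : wf_problem P)
    (hN : forall i : 'I_p, monotone_norm (N i))
    (hL : forall i : 'I_p, lipschitz_constant N L i)
    (heps : 0 < eps)
    (hlambda : 0 < lambda <= 2^-1) :
  exists K : nat, forall T : trace P, run N L eps lambda T ->
    exists kstar : nat,
      [/\ (kstar <= K)%N,
          forall k : nat, (k < kstar)%N -> ~ stops N L eps T k
        & (returns N L eps T kstar /\
           approx_global_optimal P eps (master_sol T kstar)) \/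
          (stops_infeasible N L T kstar /\ infeasible P)].
Proof.
have exw i := box_weight (hN i) (hL i).1 heps hlambda.
pose w i := projT1 (cid (exw i)).
have wP i := projT2 (cid (exw i)).
(* w is chosen before T, so this bound is uniform over all runs *)
exists (\sum_i w i (initial_box P i))%N => T Trun.
set K := (\sum_i _)%N.
have drop k : (forall k', (k' < k)%N -> ~ stops N L eps T k') ->
    exists2 c : 'I_p -> nat, (\sum_i c i + k <= K)%N &
    forall i, weight_at_most (w i) (boxes T k (i:=i)) (c i).
  elim: k => [_|k IH unst].
    exists (fun i => w i (initial_box P i)); first by rewrite addn0.
    move=> i; exists [:: initial_box P i]; last by rewrite big_seq1.
    by move=> B; rewrite Trun.1 => ->; rewrite mem_head.
  have [c cK wc] := IH (fun k' lt => unst k' (ltnW lt)).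
  have [c' lt wc'] := iteration_weight hN hL hlambda wP Trun unst wc.
  exists c' => //; rewrite addnS -addSn.
  by apply: leq_trans cK; rewrite leq_add2r.
have [k0 k0K stop0] : exists2 k, (k <= K)%N & stops N L eps T k.
  apply: contrapT => nst.
  have [|c + _] := drop K.+1; last by rewrite addnS ltnNge leq_addl.
  by move=> k kK st; apply: nst; exists k.
have ex : exists k, `[< stops N L eps T k >] by exists k0; apply/asboolP.
case: (ex_minnP ex) => k /asboolP stk kmin.
have unst k' : (k' < k)%N -> ~ stops N L eps T k'.
  by move=> lt st; move: lt; rewrite ltnNge kmin //; apply/asboolP.
exists k; split=> //;
  last exact: (first_stop_correct hN hL hlambda Trun unst stk).
exact: leq_trans (kmin k0 (asboolT stop0)) k0K.
Qed.
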